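(* Let $(\Omega,\Sigma,\mu)$ be a $\sigma$-finite complete measure space, $\phi$ an Orlicz function, and $\tau:\Omega\to\Omega$ a nonsingular measurable transformation such that the composition operator $C_\tau f=f\circ\tau$ is a bounded operator from the Orlicz space $L^\phi(\Omega)$ into itself. For $k\ge 1$ let $\mu_k=\mu\circ\tau^{-k}$, i.e. $\mu_k(A)=\mu((\tau^k)^{-1}(A))$ for $A\in\Sigma$. Then the ascent of $C_\tau$ on $L^\phi(\Omega)$ is infinite if and only if there does not exist any positive integer $k$ such that the measures $\mu_k$ and $\mu_{k+1}$ are equivalent.
   Context: An Orlicz function is a non-decreasing continuous convex function $\phi:[0,\infty)\to[0,\infty)$ with $\phi(x)=0$ if and only if $x=0$, $\lim_{x\to0}\phi(x)/x=0$ and $\lim_{x\to\infty}\phi(x)/x=\infty$. The Orlicz space $L^\phi(\Omega)$ is the set of ($\mu$-a.e. equivalence classes of) measurable functions $f$ with $\int_\Omega\phi(\alpha|f|)\,d\mu<\infty$ for some $\alpha>0$; it is a Banach space under the Luxemburg norm $\|f\|_\phi=\inf\{k>0:\int_\Omega\phi(|f|/k)\,d\mu\le1\}$. A measurable transformation $\tau:\Omega\to\Omega$ (i.e. $\tau^{-1}(A)\in\Sigma$ for all $A\in\Sigma$) is nonsingular if $\mu(\tau^{-1}(A))=0$ whenever $A\in\Sigma$ and $\mu(A)=0$. $\tau^k$ denotes the $k$-fold composition. Two measures on $\Sigma$ are equivalent if each is absolutely continuous with respect to the other. For an operator $T$ on a vector space with null spaces $N(T^k)$, the ascent of $T$ is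 the smallest natural number $k$ (natural numbers being the positive integers) such that $N(T^k)=N(T^{k+1})$; if no such $k$ exists, the ascent is infinite. *)

(* Defs.v *)
From HB Require Import structures.
From mathcomp Require Import all_boot all_order all_algebra.
From mathcomp Require Import ring lra.
From mathcomp Require Import all_classical all_reals all_analysis.
From mathcomp Require Import measurable_realfun.

Set Implicit Arguments.
Unset Strict Implicit.
Unset Printing Implicit Defensive.

Import Order.TTheory GRing.Theory Num.Def Num.Theory.
Import numFieldNormedType.Exports.

Local Open Scope classical_set_scope.
Local Open Scope ring_scope.
Local Open Scope quotient_scope.

(* Only the restriction of [orlicz_fun] to [0, +oo[ is meaningful; its values
   on negative reals are unconstrained and never used. *)
Record orliczFunction (R : realType) := OrliczFunction {
  orlicz_fun :> R -> R;
  orlicz_ge0 : forall x, 0 <= x -> 0 <= orlicz_fun x;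
  orlicz_nondecreasing :
    forall x y, 0 <= x -> x <= y -> orlicz_fun x <= orlicz_fun y;
  orlicz_continuous : {within `[0, +oo[, continuous orlicz_fun};
  orlicz_convex : convex_function (`[0, +oo[%classic : set R) orlicz_fun;
  orlicz_eq0 : forall x, 0 <= x -> (orlicz_fun x = 0 <-> x = 0);
  orlicz_cvg0 : orlicz_fun x / x @[x --> 0^'+] --> 0;
  orlicz_cvgy : orlicz_fun x / x @[x --> +oo] --> +oo }.

Section orlicz_class.
Context d (T : measurableType d) (R : realType).
Variables (mu : {measure set T -> \bar R}) (phi : orliczFunction R).

Definition orlicz_class : {pred {mfun T >-> R}} := fun f =>
  `[< exists2 a : R, 0 < a & (\int[mu]_x (phi (a * `|f x|))%:E < +oo)%E >].

Lemma measurable_orlicz (a : R) (f : T -> R) : 0 <= a ->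
  measurable_fun [set: T] f ->
  measurable_fun [set: T] (fun x => (phi (a * `|f x|))%:E).
Proof.
move=> a0 mf; apply/measurable_EFinP.
apply: (measurable_comp (F := (`[0, +oo[%classic : set R)) (f := phi)
  (g := fun x => a * `|f x|)) => //.
- by move=> _ [x _ <-]; rewrite /= in_itv/= andbT mulr_ge0.
- by apply: subspace_continuous_measurable_fun => //; exact: orlicz_continuous.
- apply: measurable_funM => //.
  exact: measurableT_comp.
Qed.

Fact orlicz_class_submod_closed : submod_closed orlicz_class.
Proof.
have phi0 : phi 0 = 0 by apply/orlicz_eq0.
split.
  apply/asboolP; exists 1 => //.
  under eq_integral do rewrite /= normr0 mulr0 phi0.
  by rewrite integral0.
move=> c f g /asboolP[a a0 fa] /asboolP[b b0 gb]; apply/asboolP.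
have c10 : 0 < `|c| + 1 by rewrite ltr_wpDl.
pose e := Num.min (a / (`|c| + 1)) b / 2.
have e0 : 0 < e by rewrite divr_gt0// lt_min divr_gt0.
have ea : e * `|c| <= a / 2.
  rewrite /e mulrAC ler_pM2r ?invr_gt0//.
  apply: (@le_trans _ _ (a / (`|c| + 1) * `|c|)).
    by rewrite ler_wpM2r// ge_min lexx.
  by rewrite mulrAC ler_pdivrMr// ler_pM2l// lerDl.
have eb : e <= b / 2 by rewrite /e ler_pM2r ?invr_gt0// ge_min lexx orbT.
exists e => //.
apply: (@le_lt_trans _ _ (\int[mu]_x
    ((phi (a * `|f x|))%:E + (phi (b * `|g x|))%:E))%E); last first.
  rewrite ge0_integralD//; first exact: lte_add_pinfty.
  - by move=> x _; rewrite lee_fin orlicz_ge0// mulr_ge0// ltW.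
  - exact: measurable_orlicz (ltW a0) _.
  - by move=> x _; rewrite lee_fin orlicz_ge0// mulr_ge0// ltW.
  - exact: measurable_orlicz (ltW b0) _.
apply: ge0_le_integral => //.
- by move=> x _; rewrite lee_fin orlicz_ge0// mulr_ge0// ltW.
- by apply: measurable_orlicz (ltW e0) _; exact: measurable_funP.
- apply: emeasurable_funD.
  + exact: measurable_orlicz (ltW a0) _.
  + exact: measurable_orlicz (ltW b0) _.
move=> x _; rewrite -EFinD lee_fin.
have u0 : 0 <= a * `|f x| by rewrite mulr_ge0// ltW.
have v0 : 0 <= b * `|g x| by rewrite mulr_ge0// ltW.
have H : e * `|(c *: f + g) x| <= (a * `|f x| + b * `|g x|) / 2.
  apply: (@le_trans _ _ (e * (`|c| * `|f x| + `|g x|))).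
    rewrite ler_wpM2l ?(ltW e0)//.
    by rewrite (le_trans (ler_normD _ _))//= normrM.
  rewrite mulrDr mulrA mulrDl.
  by apply: lerD; rewrite [leRHS]mulrAC ler_wpM2r.
have H0 : 0 <= e * `|(c *: f + g) x| by rewrite mulr_ge0// ltW.
have [uv|/ltW vu] := leP (a * `|f x|) (b * `|g x|).
- apply: (@le_trans _ _ (phi (b * `|g x|))).
    apply: orlicz_nondecreasing => //; lra.
  by rewrite lerDr orlicz_ge0.
- apply: (@le_trans _ _ (phi (a * `|f x|))).
    apply: orlicz_nondecreasing => //; lra.
  by rewrite lerDl orlicz_ge0.
Qed.

HB.instance Definition _ := GRing.isSubmodClosed.Build _ _ orlicz_class
  orlicz_class_submod_closed.

Record orliczFun := OrliczFun {
  orlicz_mfun :> {mfun T >-> R};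
  orlicz_mfunP : orlicz_mfun \in orlicz_class }.

HB.instance Definition _ := [isSub for orlicz_mfun].
HB.instance Definition _ := [Choice of orliczFun by <:].
HB.instance Definition _ := [SubChoice_isSubLmodule of orliczFun by <:].

Definition orlicz_ae_eq (f g : orliczFun) := `[< f = g %[ae mu] >].

Fact orlicz_ae_eq_refl : reflexive orlicz_ae_eq.
Proof. by move=> f; apply/asboolP/aeW. Qed.

Fact orlicz_ae_eq_sym : symmetric orlicz_ae_eq.
Proof.
by move=> f g; apply/idP/idP => /asboolP h; apply/asboolP/ae_eq_sym.
Qed.

Fact orlicz_ae_eq_trans : transitive orlicz_ae_eq.
Proof.
by move=> f g h /asboolP gf /asboolP fh; apply/asboolP/(ae_eq_trans gf fh).
Qed.

Canonical orlicz_ae_eq_equiv := EquivRel orlicz_ae_eq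
  orlicz_ae_eq_refl orlicz_ae_eq_sym orlicz_ae_eq_trans.

Definition orliczSpace : Type := {eq_quot orlicz_ae_eq}.
HB.instance Definition _ := Choice.on orliczSpace.
HB.instance Definition _ := EqQuotient.on orliczSpace.

Definition orlicz_repr (u : orliczSpace) : orliczFun := repr u.
Coercion orlicz_repr : orliczSpace >-> orliczFun.

Lemma orlicz_piP (f g : orliczFun) :
  \pi_orliczSpace f = \pi_orliczSpace g <-> f = g %[ae mu].
Proof. by split=> [/eqmodP/asboolP//|fg]; apply/eqmodP/asboolP. Qed.

Lemma orlicz_reprP (f : orliczFun) : orlicz_repr (\pi_orliczSpace f) = f %[ae mu].
Proof. by apply/orlicz_piP; rewrite /orlicz_repr reprK. Qed.

Definition orlicz_zero : orliczSpace := lift_cst orliczSpace 0.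
Definition orlicz_opp := lift_op1 orliczSpace (fun f => - f).
Definition orlicz_add := lift_op2 orliczSpace (fun f g => f + g).
Definition orlicz_scale (a : R) := lift_op1 orliczSpace (fun f => a *: f).

Canonical orlicz_zero_morph := PiConst orlicz_zero.

Lemma orlicz_pi_opp : {morph \pi_orliczSpace : f / - f >-> orlicz_opp f}.
Proof.
move=> f; unlock orlicz_opp; apply/orlicz_piP.
by apply: filterS (orlicz_reprP f) => x /= /[apply] fx; congr (- _).
Qed.
Canonical orlicz_opp_morph := PiMorph1 orlicz_pi_opp.

Lemma orlicz_pi_add :
  {morph \pi_orliczSpace : f g / f + g >-> orlicz_add f g}.
Proof.
move=> f g; unlock orlicz_add; apply/orlicz_piP.
by apply: filterS2 (orlicz_reprP f) (orlicz_reprP g) => x /= fx gx _;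
  congr (_ + _); [rewrite -(fx I)|rewrite -(gx I)].
Qed.
Canonical orlicz_add_morph := PiMorph2 orlicz_pi_add.

Lemma orlicz_pi_scale a :
  {morph \pi_orliczSpace : f / a *: f >-> orlicz_scale a f}.
Proof.
move=> f; unlock orlicz_scale; apply/orlicz_piP.
by apply: filterS (orlicz_reprP f) => x /= /[apply] fx; congr (_ * _).
Qed.
Canonical orlicz_scale_morph a := PiMorph1 (orlicz_pi_scale a).

Fact orlicz_addA : associative orlicz_add.
Proof. by move=> x y z; rewrite -[x]reprK -[y]reprK -[z]reprK !piE addrA. Qed.
Fact orlicz_addC : commutative orlicz_add.
Proof. by move=> x y; rewrite -[x]reprK -[y]reprK !piE addrC. Qed.
Fact orlicz_add0 : left_id orlicz_zero orlicz_add.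
Proof. by move=> x; rewrite -[x]reprK !piE add0r. Qed.
Fact orlicz_addN : left_inverse orlicz_zero orlicz_opp orlicz_add.
Proof. by move=> x; rewrite -[x]reprK !piE addNr. Qed.

HB.instance Definition _ := GRing.isZmodule.Build orliczSpace
  orlicz_addA orlicz_addC orlicz_add0 orlicz_addN.

Fact orlicz_scaleA a b x :
  orlicz_scale a (orlicz_scale b x) = orlicz_scale (a * b) x.
Proof. by rewrite -[x]reprK !piE scalerA. Qed.
Fact orlicz_scale1 : left_id 1 orlicz_scale.
Proof. by move=> x; rewrite -[x]reprK !piE scale1r. Qed.
Fact orlicz_scaleDr : right_distributive orlicz_scale +%R.
Proof.
move=> a x y; rewrite -[x]reprK -[y]reprK.
by rewrite -[LHS]/(orlicz_scale a (orlicz_add _ _))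
  -[RHS]/(orlicz_add (orlicz_scale a _) (orlicz_scale a _)) !piE scalerDr.
Qed.
Fact orlicz_scaleDl x : {morph orlicz_scale^~ x : a b / a + b}.
Proof.
move=> a b; rewrite -[x]reprK.
by rewrite -[RHS]/(orlicz_add (orlicz_scale a _) (orlicz_scale b _)) !piE
  scalerDl.
Qed.

HB.instance Definition _ := GRing.Zmodule_isLmodule.Build R orliczSpace
  orlicz_scaleA orlicz_scale1 orlicz_scaleDr orlicz_scaleDl.

Lemma orlicz_pi_linear : linear (\pi_orliczSpace : orliczFun -> orliczSpace).
Proof.
move=> a f g.
by rewrite -[RHS]/(orlicz_add (orlicz_scale a _) _) !piE.
Qed.

Definition luxemburg_set (f : T -> R) : set R :=
  [set k | 0 < k /\ (\int[mu]_x (phi (`|f x| / k))%:E <= 1)%E].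

Definition luxemburg (u : orliczSpace) : R := inf (luxemburg_set u).

(* The infimum is that of a nonempty set of positive reals. *)
Lemma luxemburg_set_has_inf (f : orliczFun) : has_inf (luxemburg_set f).
Proof.
split; last by exists 0 => k [/ltW].
have phi0 : phi 0 = 0 by apply/orlicz_eq0.
have /asboolP[a a0 fa] := orlicz_mfunP f.
set I := (\int[mu]_x (phi (a * `|f x|))%:E)%E in fa.
have I0 : (0 <= I)%E.
  by apply: integral_ge0 => x _; rewrite lee_fin orlicz_ge0// mulr_ge0// ltW.
have Ifin : I \is a fin_num by rewrite ge0_fin_numE.
have fI0 : 0 <= fine I by rewrite fine_ge0.
have I10 : 0 < fine I + 1 by rewrite ltr_wpDl.
pose t := (fine I + 1)^-1.
have t0 : 0 < t by rewrite invr_gt0.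
have t1 : t <= 1 by rewrite invf_le1// lerDr.
exists (a * t)^-1; split; first by rewrite invr_gt0 mulr_gt0.
apply: (@le_trans _ _ (t%:E * I)%E); last first.
  rewrite -(fineK Ifin) -EFinM lee_fin /t mulrC ler_pdivrMr// mul1r.
  by rewrite lerDl.
rewrite /I -ge0_integralZl//; first last.
- by rewrite lee_fin ltW.
- by move=> x _; rewrite lee_fin orlicz_ge0// mulr_ge0// ltW.
- exact: measurable_orlicz (ltW a0) _.
apply: ge0_le_integral => //.
- by move=> x _; rewrite lee_fin orlicz_ge0// mulr_ge0// invrK mulr_ge0// ltW.
- rewrite invrK; under eq_fun do rewrite mulrC.
  by apply: measurable_orlicz => //; rewrite mulr_ge0// ltW.
- apply: measurable_funeM; exact: measurable_orlicz (ltW a0) _.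
move=> x _; rewrite -EFinM lee_fin invrK.
have t01 : 0 <= t <= 1 by rewrite (ltW t0).
pose s : {i01 R} := Itv01 (ltW t0) t1.
have := @orlicz_convex _ phi s (a * `|f x|) 0.
rewrite !inE/= !in_itv/= lexx !andbT => /(_ _ _).
rewrite mulr_ge0// ?(ltW a0)// => /(_ isT isT).
rewrite !convRE/= phi0 !mulr0 !addr0; congr (phi _ <= _).
by rewrite [LHS](convRE (a * `|f x|) 0 s)/= mulr0 addr0 mulrA mulrC (mulrC t).
Qed.

Lemma luxemburgE (f : orliczFun) :
  luxemburg (\pi_orliczSpace f) = inf (luxemburg_set f).
Proof.
rewrite /luxemburg; congr inf; apply/seteqP.
suff H (g h : orliczFun) : g = h %[ae mu] ->
    luxemburg_set g `<=` luxemburg_set h.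
  by split; apply: H; [|apply: ae_eq_sym]; exact: orlicz_reprP.
move=> gh k [k0 gk]; split=> //; apply: le_trans gk.
have mp (f' : orliczFun) :
    measurable_fun [set: T] (fun x => (phi (`|f' x| / k))%:E).
  under eq_fun do rewrite mulrC.
  by apply: measurable_orlicz => //; rewrite invr_ge0 ltW.
rewrite (@ge0_ae_eq_integral _ _ _ mu setT (fun x => (phi (`|h x| / k))%:E)
  (fun x => (phi (`|g x| / k))%:E))//.
- by move=> x _; rewrite lee_fin orlicz_ge0// divr_ge0// ltW.
- by move=> x _; rewrite lee_fin orlicz_ge0// divr_ge0// ltW.
- by apply: filterS gh => x /= /[apply] ->.
Qed.

(* [C] maps the class of f to the class of f \o tau; this includes the
   requirement that f \o tau belong to the Orlicz space. *)
Definition composition_operator (tau : T -> T)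
    (C : orliczSpace -> orliczSpace) :=
  forall f : orliczFun, C (\pi_orliczSpace f) = f \o tau %[ae mu].

Definition luxemburg_bounded (C : orliczSpace -> orliczSpace) :=
  exists M : R, forall u : orliczSpace, luxemburg (C u) <= M * luxemburg u.

End orlicz_class.

Definition nonsingular d (T : measurableType d) (R : realType)
    (mu : set T -> \bar R) (tau : T -> T) :=
  forall A, measurable A -> mu A = 0%E -> mu (tau @^-1` A) = 0%E.

Definition equivalent_measures d (T : measurableType d) (R : realType)
    (m1 m2 : set T -> \bar R) := m1 `<< m2 /\ m2 `<< m1.

Section ascent.
Context (K : pzRingType) (V : lmodType K) (C : {linear V -> V}).

Definition null_space (k : nat) : set V := [set v | iter k C v = 0].

Definition null_stable : pred nat := fun k =>
  (0 < k)%N && `[< null_space k = null_space k.+1 >].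

Definition ascent : \bar nat :=
  if pselect (exists k, null_stable k) is left ex then EFin (ex_minn ex)
  else +oo%E.

End ascent.

(* Main.v *)
Require Import Defs.
From mathcomp Require Import all_boot all_order all_algebra.
From mathcomp Require Import all_classical all_reals all_analysis.
From mathcomp Require Import measurable_realfun.
Set Implicit Arguments.
Unset Strict Implicit.
Unset Printing Implicit Defensive.

Import Order.TTheory GRing.Theory Num.Theory.
Import numFieldNormedType.Exports.
Local Open Scope classical_set_scope.
Local Open Scope ring_scope.

(** Write mu_k for the image of mu under the k-th iterate of tau. The k-th
power of the composition operator C maps the class of f to the class of
f \o tau^k, hence its null space consists of the classes of those f for which
the set where f does not vanish is mu_k-null ([null_space_pushforwardP]). So
the null spaces only see the null sets of the measures mu_k, and they see all
of them: by sigma-finiteness, a measurable set A is a countable union of sets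
of finite measure, whose indicator functions belong to the Orlicz space, and
A is mu_k-null as soon as all these indicators lie in the null space of the
k-th power. Therefore, N(C^k) contains N(C^(k+1)) if and only if mu_k is
absolutely continuous with respect to mu_(k+1).

The reverse inclusion and the reverse absolute continuity always hold, the
former since C 0 = 0 and the latter by nonsingularity of tau. Thus
N(C^k) = N(C^(k+1)) if and only if mu_k and mu_(k+1) are equivalent
([null_stableP]), and the ascent is infinite exactly when this happens for no
positive k. *)

(** * Null sets of image measures *)

Section image_null_sets.
Context d (T : measurableType d) (R : realType).
Variable mu : {measure set T -> \bar R}.

Lemma pushforward_null_dominatesP (f g : T -> T) :
  measurable_fun [set: T] g ->
  pushforward mu f `<< pushforward mu g <->
  forall A, measurable A -> mu (g @^-1` A) = 0%E -> mu (f @^-1` A) = 0%E.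
Proof.
move=> mg; split=> [fg A mA gA0|fg N N0 A mA AN].
  apply: (fg A) => // B mB BA; apply: subset_measure0 gA0.
  - by rewrite -[X in measurable X]setTI; exact: mg.
  - by rewrite -[X in measurable X]setTI; exact: mg.
  - exact: preimage_subset.
by apply: fg => //; exact: N0.
Qed.

Lemma measurable_fun_iter (tau : T -> T) k :
  measurable_fun [set: T] tau -> measurable_fun [set: T] (iter k tau).
Proof.
move=> mtau; elim: k => [|k ih]; first exact: measurable_id.
exact: measurableT_comp.
Qed.

(** The exceptional set lies in a measurable null set, to whose preimage
nonsingularity applies. This is what makes composition with tau well defined
on almost everywhere equality classes. *)
Lemma nonsingular_ae_eq (tau : T -> T) (f g : T -> R) :
  measurable_fun [set: T] tau -> nonsingular mu tau ->
  f = g %[ae mu] -> f \o tau = g \o tau %[ae mu].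
Proof.
move=> mtau ns [N [mN N0 fgN]]; exists (tau @^-1` N); split.
- by rewrite -[X in measurable X]setTI; exact: mtau.
- exact: ns.
- by move=> x; exact: (fgN (tau x)).
Qed.

(** The half of the equivalence of consecutive image measures that always
holds: the preimage of a set under tau^(k+1) is the preimage under tau of its
preimage under tau^k, and nonsingularity applies to the latter. *)
Lemma pushforward_iterS_dominates (tau : T -> T) k :
  measurable_fun [set: T] tau -> nonsingular mu tau ->
  pushforward mu (iter k.+1 tau) `<< pushforward mu (iter k tau).
Proof.
move=> mtau ns; have mtauk := measurable_fun_iter k mtau.
apply/(pushforward_null_dominatesP _ mtauk) => A mA kA0.
have -> : iter k.+1 tau @^-1` A = tau @^-1` (iter k tau @^-1` A).
  by apply/seteqP; split => x; rewrite /preimage /= -iterS iterSr.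
by apply: ns => //; rewrite -[X in measurable X]setTI; exact: mtauk.
Qed.

End image_null_sets.

(** * Null spaces of the powers of a composition operator *)

Section null_spaces.
Context d (T : measurableType d) (R : realType).
Variables (mu : {measure set T -> \bar R}) (phi : orliczFunction R).

(** With scaling factor 1, the modular of the indicator function of A is
phi(1) mu(A). *)
Lemma indic_orlicz_class (A : set T) (mA : measurable A) :
  (mu A < +oo)%E -> (indic_mfun A mA : {mfun T >-> R}) \in orlicz_class mu phi.
Proof.
move=> Afin; apply/asboolP; exists 1 => //.
have phi0 : phi 0 = 0 by apply/orlicz_eq0.
have phi1 : 0 <= phi 1 by exact: orlicz_ge0.
under eq_integral => x _.
  have -> : (phi (1 * `|(indic_mfun A mA : {mfun T >-> R}) x|))%:E =
      ((phi 1)%:E * (\1_A x)%:E)%E.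
    rewrite /indic_mfun /= /mindic indicE mul1r.
    by case: (x \in A); rewrite ?normr1 ?normr0 ?phi0 ?mule1 ?mule0.
  over.
rewrite ge0_integralZl//; last first.
  by apply/measurable_EFinP; exact: measurable_indic.
rewrite integral_indic// setIT.
by rewrite lte_mul_pinfty.
Qed.

Variable tau : T -> T.
Variable C : {linear orliczSpace mu phi -> orliczSpace mu phi}.
Hypothesis mtau : measurable_fun [set: T] tau.
Hypothesis ns : nonsingular mu tau.
Hypothesis Ctau : composition_operator tau C.

(** Each application of C acts on a representative of the class obtained so
far, which is known only up to a null set; nonsingularity keeps the preimages
of these exceptional sets null. *)
Lemma iter_composition_operator k (f : orliczFun mu phi) :
  orlicz_repr (iter k C (\pi_(orliczSpace mu phi)%qT f)) =
  f \o iter k tau %[ae mu].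
Proof.
elim: k => [|k ih]; first exact: orlicz_reprP.
rewrite iterS; set u := iter k C _ in ih *.
have Cu : orlicz_repr (C u) = orlicz_repr u \o tau %[ae mu].
  by have := Ctau (orlicz_repr u); rewrite /orlicz_repr reprK.
apply: (ae_eq_trans Cu).
have -> : f \o iter k.+1 tau = (f \o iter k tau) \o tau.
  by apply/funext => x; rewrite /= -iterS iterSr.
exact: nonsingular_ae_eq.
Qed.

Lemma orliczSpace_eq0 (u : orliczSpace mu phi) :
  u = 0 <-> orlicz_repr u = cst 0 %[ae mu].
Proof.
have pi0 : \pi_(orliczSpace mu phi)%qT 0 = 0 by rewrite !piE.
have -> : u = 0 <-> \pi_(orliczSpace mu phi)%qT (orlicz_repr u) =
    \pi_(orliczSpace mu phi)%qT 0.
  by rewrite pi0 /orlicz_repr reprK.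
exact: orlicz_piP.
Qed.

Lemma measurable_neq0 (f : orliczFun mu phi) :
  measurable [set x | f x != 0].
Proof.
have -> : [set x | f x != 0] = f @^-1` [set~ 0].
  by apply/seteqP; split => x /= /eqP.
have mf : measurable_fun [set: T] f by [].
by rewrite -[X in measurable X]setTI; apply: mf => //; exact: measurableC.
Qed.

(** The k-th power sends f to f \o tau^k almost everywhere, and the latter is
nonzero exactly on the preimage under tau^k of the set where f is nonzero. *)
Lemma null_space_pushforwardP k (f : orliczFun mu phi) :
  null_space C k (\pi_(orliczSpace mu phi)%qT f) <->
  pushforward mu (iter k tau) [set x | f x != 0] = 0%E.
Proof.
have mk := measurable_fun_iter k mtau.
have mS : measurable (iter k tau @^-1` [set x | f x != 0]).
  by rewrite -[X in measurable X]setTI; apply: mk => //; exact: measurable_neq0.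
have itf := iter_composition_operator k f.
have -> : null_space C k (\pi_(orliczSpace mu phi)%qT f) <->
    f \o iter k tau = cst 0 %[ae mu].
  rewrite /null_space /= orliczSpace_eq0; split=> h.
    by apply: ae_eq_trans h; exact: ae_eq_sym.
  exact: ae_eq_trans h.
rewrite /pushforward -(negligibleP mu mS).
suff -> : iter k tau @^-1` [set x | f x != 0] =
    ~` [set x | setT x -> (f \o iter k tau) x = cst 0 x] by [].
apply/seteqP; split=> x /=; first by move=> /eqP fx0 h; apply: fx0; exact: h.
by move=> h; apply/eqP => fx0; apply: h.
Qed.

Lemma null_space_subsetS k : null_space C k `<=` null_space C k.+1.
Proof. by move=> u; rewrite /null_space /= => ->; rewrite linear0. Qed.

(** Testing an inclusion of null spaces on indicator functions is enough to
compare null sets of finite measure; sigma-finiteness then gives all null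
sets by countable subadditivity. *)
Lemma null_space_subsetP k l : sigma_finite [set: T] mu ->
  null_space C l `<=` null_space C k <->
  pushforward mu (iter k tau) `<< pushforward mu (iter l tau).
Proof.
move=> [F FT Ffin].
have ml := measurable_fun_iter l mtau.
rewrite (pushforward_null_dominatesP mu _ ml); split=> [lk A mA lA0|lk u].
- have mAF n : measurable (A `&` F n).
    by apply: measurableI => //; case: (Ffin n).
  have mpre j B : measurable B -> measurable (iter j tau @^-1` B).
    move=> mB; rewrite -[X in measurable X]setTI.
    exact: (measurable_fun_iter j mtau).
  have AE : A = \bigcup_n (A `&` F n) by rewrite -setI_bigcupr -FT setIT.
  apply/negligibleP; first exact: mpre.
  rewrite AE preimage_bigcup; apply: negligible_bigcup => n.
  apply/negligibleP; first exact: mpre.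
  have AFfin : (mu (A `&` F n) < +oo)%E.
    apply: le_lt_trans (Ffin n).2; apply: le_measure; rewrite ?inE//.
    by case: (Ffin n).
  pose f := OrliczFun (indic_orlicz_class (mAF n) AFfin).
  have fE : [set x | f x != 0] = A `&` F n.
    apply/seteqP; split=> x; rewrite /f /= /mindic indicE.
      by case: (boolP (x \in _)) => [/set_mem//|_]; rewrite eqxx.
    by move=> AFx; rewrite (mem_set (AFx : (A `&` F n) x)) oner_eq0.
  rewrite -fE; apply/null_space_pushforwardP/lk/null_space_pushforwardP.
  rewrite fE /pushforward; apply: subset_measure0 lA0; try exact: mpre.
  by apply: preimage_subset; exact: subIsetl.
- rewrite -[u]reprK => /null_space_pushforwardP lu0.
  by apply/null_space_pushforwardP/lk => //; exact: measurable_neq0.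
Qed.

Lemma null_stableP k : sigma_finite [set: T] mu ->
  null_stable C k <-> (0 < k)%N /\
    equivalent_measures (pushforward mu (iter k tau))
                        (pushforward mu (iter k.+1 tau)).
Proof.
move=> sf; rewrite /null_stable; split.
  move=> /andP[k0 /asboolP kE]; split=> //; split.
    by apply/null_space_subsetP => //; rewrite kE.
  exact: pushforward_iterS_dominates.
move=> [k0 [kS _]]; apply/andP; split=> //; apply/asboolP/seteqP; split.
  exact: null_space_subsetS.
exact/null_space_subsetP.
Qed.

End null_spaces.

Theorem corollary3p2 (d : measure_display) (T : measurableType d)
    (R : realType) (mu : {measure set T -> \bar R}) (phi : orliczFunction R)
    (tau : T -> T) (C : {linear orliczSpace mu phi -> orliczSpace mu phi}) :
  sigma_finite [set: T] mu ->
  measure_is_complete mu ->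
  measurable_fun [set: T] tau ->
  nonsingular mu tau ->
  composition_operator tau C ->
  luxemburg_bounded C ->
  ascent C = +oo%E <->
  ~ exists k : nat, (0 < k)%N /\
      equivalent_measures (pushforward mu (iter k tau))
                          (pushforward mu (iter k.+1 tau)).
Proof.
move=> sf _ mtau ns Ctau _.
have stableP k := null_stableP mtau ns Ctau k sf.
rewrite /ascent; case: pselect => [ex|nex]; split=> //.
- by case; case: ex => k /stableP hk; exists k.
- by move=> _ [k /stableP hk]; apply: nex; exists k.
Qed.
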